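(* Let $\theta$ be a real number. Every connected $\theta$-base graph is $\theta$-elementary.
   Context: All graphs are finite and simple. $\mu(G,x)=\sum_{r\ge0}(-1)^r p(G,r)x^{n-2r}$ is the matching polynomial of a graph $G$ on $n$ vertices, where $p(G,r)$ is the number of $r$-matchings ($p(G,0)=1$); $\mathrm{mult}(\theta,G)$ is the multiplicity of $\theta$ as a root of $\mu(G,x)$. $G\setminus X$ denotes deletion of the vertex set $X$. A vertex $u$ of $H$ is $\theta$-essential if $\mathrm{mult}(\theta,H\setminus u)=\mathrm{mult}(\theta,H)-1$, $\theta$-positive if $\mathrm{mult}(\theta,H\setminus u)=\mathrm{mult}(\theta,H)+1$, and $\theta$-special if it is not $\theta$-essential but is adjacent to a $\theta$-essential vertex; $P_\theta(H)$ is the set of $\theta$-positive, non-$\theta$-special vertices of $H$. $G$ is $\theta$-super positive if $\mathrm{mult}(\theta,G)=0$ and every vertex is $\theta$-positive; $G$ is $\theta$-elementary if it is $\theta$-super positive and $P_\theta(G\setminus v)=\varnothing$ for all $v$. A graph $H$ is $\theta$-critical if all its vertices are $\theta$-essential and $\mathrm{mult}(\theta,H)=1$; $c_\theta(H)$ is the number of $\theta$-critical components of $H$. $X\subseteq V(G)$ is a $\theta$-barrier set if $\mathrm{mult}(\theta,G)=c_\theta(G\setminus X)-|X|$; $\mathfrak P(\theta,G)$ is the set of all $\theta$-barrier sets. A set of vertices is independent if no two of its vertices are adjacent. $G$ is $\theta$-base if it is $\theta$-super positive and every $S\in\mathfrak P(\theta,G)$ is independent. *)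

(* Defs.v *)
From mathcomp Require Import all_boot all_order all_algebra.
From mathcomp Require Import reals.

Set Implicit Arguments.
Unset Strict Implicit.
Unset Printing Implicit Defensive.

Import GRing.Theory.
Local Open Scope ring_scope.

Record sgraph := SGraph {
  vertex :> finType;
  adj : rel vertex;
  adj_sym : symmetric adj;
  adj_irr : irreflexive adj
}.

(* Every graph other than G itself is an induced subgraph of G, given by its
   vertex set H : {set G}. Thus G is [set: G], H \ X is H :\: X and H \ v is
   H :\ v, and each notion below is defined for the graph G[H]. *)

Section InducedSubgraphs.
Variable G : sgraph.
Implicit Types (H S X : {set G}) (u v w : G).

Definition edges H : {set {set G}} :=
  [set [set p.1; p.2] | p : G * G
                      & [&& p.1 \in H, p.2 \in H & adj p.1 p.2]].

Definition matchings H (r : nat) : {set {set {set G}}} :=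
  [set M : {set {set G}} | [&& M \subset edges H, trivIset M & #|M| == r]].

Definition adj_in H : rel G :=
  fun u v => [&& u \in H, v \in H & adj u v].

Definition components H : {set {set G}} :=
  equivalence_partition (connect (adj_in H)) H.

Definition connected H : bool :=
  [forall u in H, forall v in H, connect (adj_in H) u v].

Definition independent S : bool :=
  [forall u in S, forall v in S, ~~ adj u v].

Variables (R : realType) (theta : R).

(* An r-matching covers 2r vertices, so there is none for r > #|H|./2; on the
   remaining range the subtraction in nat is exact. *)
Definition matching_poly H : {poly R} :=
  \sum_(r < #|H|./2.+1) (-1) ^+ r * #|matchings H r|%:R *: 'X^(#|H| - 2 * r).

Definition mult H : nat := mup theta (matching_poly H).

Definition essential H u : bool := (mult (H :\ u)).+1 == mult H.

Definition positive H u : bool := mult (H :\ u) == (mult H).+1.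

Definition special H u : bool :=
  ~~ essential H u && [exists w in H, adj u w && essential H w].

Definition positive_nonspecial H : {set G} :=
  [set u in H | positive H u && ~~ special H u].

Definition super_positive H : bool :=
  (mult H == 0%N) && [forall v in H, positive H v].

Definition elementary H : bool :=
  super_positive H && [forall v in H, positive_nonspecial (H :\ v) == set0].

Definition critical H : bool :=
  [forall u in H, essential H u] && (mult H == 1%N).

Definition num_critical H : nat := #|[set C in components H | critical C]|.

(* mult H = num_critical (H :\: X) - #|X| as integers: subtraction in nat would
   be truncated. *)
Definition barrier H X : bool :=
  (X \subset H) && (mult H + #|X| == num_critical (H :\: X))%N.

Definition barriers H : {set {set G}} := [set X : {set G} | barrier H X].

Definition base H : bool :=
  super_positive H && [forall S in barriers H, independent S].

End InducedSubgraphs.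

(* Main.v *)
(* Let G be theta-super positive, X a barrier of G, D the union of the |X|
   theta-critical components of G \ X and B the rest of G \ X. Expanding mu(G)
   along X gives mu(G)(theta) = mu(X + D)(theta) mu(B)(theta), and likewise
   with B \ u for B, so B is theta-super positive as well. Hence every u in B
   lies in a barrier X + u + A of G, where A is a barrier of B \ u. If barriers
   are independent, no such u has a neighbour in X; so if G is also connected
   and X is nonempty, then B is empty.
   Now let w be in P_theta(G \ v). The theta-analogue of the Gallai-Edmonds
   theorem gives a barrier A of G \ v with w neither in A nor in a critical
   component of G \ v \ A. Then X = A + v is a barrier of G whose B contains w.
   The Gallai-Edmonds part rests on the Heilmann-Lieb identity, which exhibits
   mu(H \ u) mu(H \ v) - mu(H) mu(H \ u \ v) as a sum of squares: such a
   polynomial vanishes at theta to even order. *)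

Require Import Defs.
From mathcomp Require Import all_boot all_order all_algebra.
From mathcomp Require Import reals.
From mathcomp Require Import zify ring.

Set Implicit Arguments.
Unset Strict Implicit.
Unset Printing Implicit Defensive.

Import Order.TTheory GRing.Theory Num.Theory.
Local Open Scope ring_scope.

(** * The vertex recurrence *)

Section MatchingRecurrence.
Variables (G : sgraph) (R : realType).
Implicit Types (H : {set G}) (M : {set {set G}}) (u v w : G).

Definition is_matching H M := (M \subset edges H) && trivIset M.

Lemma adj_neq u v : adj u v -> u != v.
Proof. by apply: contraTneq => ->; rewrite adj_irr. Qed.

Lemma edgesP H (e : {set G}) :
  reflect (exists u v, [/\ u \in H, v \in H, adj u v & e = [set u; v]])
          (e \in edges H).
Proof.
apply: (iffP imsetP) => [[[u v]]|[u [v [uH vH uv ->]]]].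
  by rewrite inE /= => /and3P[uH vH uv ->]; exists u, v.
by exists (u, v) => //; rewrite inE /= uH vH.
Qed.

Lemma card_edge H (e : {set G}) : e \in edges H -> #|e| = 2%N.
Proof. by case/edgesP=> u [v [_ _ uv ->]]; rewrite cards2 adj_neq. Qed.

Lemma edge_sub H (e : {set G}) : e \in edges H -> e \subset H.
Proof.
by case/edgesP=> u [v [uH vH _ ->]]; apply/subsetP=> x /set2P[]->.
Qed.

Lemma edgesS (A B : {set G}) : A \subset B -> edges A \subset edges B.
Proof.
move=> sAB; apply/subsetP=> e /edgesP[u [v [uA vA uv ->]]].
by apply/edgesP; exists u, v; rewrite !(subsetP sAB).
Qed.

Lemma edges_subset H (K e : {set G}) :
  e \in edges H -> e \subset K -> e \in edges K.
Proof.
case/edgesP=> u [v [_ _ uv ->]] /subsetP sK.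
by apply/edgesP; exists u, v; rewrite !sK ?set21 ?set22.
Qed.

Lemma matching_cover_sub H M : is_matching H M -> cover M \subset H.
Proof.
case/andP=> /subsetP sM _; apply/bigcupsP=> e eM.
exact: edge_sub (sM _ eM).
Qed.

Lemma matching_card H M : is_matching H M -> (#|M| * 2 <= #|H|)%N.
Proof.
move=> mM; have sH := matching_cover_sub mM; case/andP: mM => /subsetP sM tM.
apply: leq_trans (subset_leq_card sH).
rewrite -(eqP tM) (eq_bigr (fun=> 2%N)) ?sum_nat_const // => e eM.
exact: card_edge (sM _ eM).
Qed.

(** Summing over the matchings themselves, rather than over their sizes, allows the recurrence below
    to be proved by reindexing. *)
Lemma matching_polyE H : matching_poly R H =
  \sum_(M | is_matching H M) (-1) ^+ #|M| *: 'X^(#|H| - 2 * #|M|).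
Proof.
have cardM M : is_matching H M -> (#|M| < #|H|./2.+1)%N.
  by move=> /matching_card; lia.
pose f M : 'I_#|H|./2.+1 := inord #|M|.
rewrite (partition_big f predT) //=; apply: eq_bigr => r _.
rewrite (eq_bigl (fun M => M \in matchings H r)); last first.
  move=> M; rewrite inE andbA -/(is_matching H M).
  have [mM|//] := boolP (is_matching H M).
  by rewrite /= -val_eqE /= inordK // cardM.
rewrite (eq_bigr (fun=> (-1) ^+ r *: 'X^(#|H| - 2 * r))); last first.
  by move=> M; rewrite inE => /and3P[_ _ /eqP->].
by rewrite sumr_const -scalerA scaler_nat scalerMnr.
Qed.

Lemma matching_poly0 : matching_poly R (set0 : {set G}) = 1.
Proof.
rewrite matching_polyE (big_pred1 set0) ?cards0 ?expr0 ?scale1r ?expr0 // => M.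
apply/idP/eqP=> [/matching_card|->].
  by rewrite cards0 leqn0 muln_eq0 orbF cards_eq0 => /eqP.
rewrite /is_matching sub0set /=; apply/trivIsetP=> A B; by rewrite inE.
Qed.

Lemma matching_del H M u : u \in H ->
  is_matching H M && (u \notin cover M) = is_matching (H :\ u) M.
Proof.
move=> uH; rewrite /is_matching; case: (trivIset M); rewrite ?andbF ?andbT //.
apply/idP/idP=> [/andP[/subsetP sM ucov]|sM].
  apply/subsetP=> e eM; apply: (edges_subset (sM _ eM)).
  rewrite subsetD1 (edge_sub (sM _ eM)); apply: contra ucov => ue.
  by apply/bigcupP; exists e.
rewrite (subset_trans sM (edgesS _)) ?subD1set //=.
apply/bigcupP=> -[e /(subsetP sM)/edge_sub/subsetP se /se].
by rewrite !inE eqxx.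
Qed.

(** The second conjunct says that the edge is not in [M]; the pair has the shape of the side
    condition that [reindex_onto] leaves in the recurrence. *)
Lemma matching_addE H M u v : u \in H -> v \in H -> adj u v ->
  is_matching H ([set u; v] |: M) && (([set u; v] |: M) :\ [set u; v] == M)
  = is_matching (H :\ u :\ v) M.
Proof.
move=> uH vH uv; set e := [set u; v]; set K := H :\ u :\ v.
have uv' := adj_neq uv.
have KE : K = H :\: e.
  by apply/setP=> x; rewrite !inE; case: (x == u); case: (x == v).
have eE : e \in edges H by apply/edgesP; exists u, v.
apply/idP/idP=> [/andP[/andP[sM tM] /eqP eM]|mM].
  have e'M : e \notin M by rewrite -eM !inE eqxx.
  have /trivIsetP tM' := tM; rewrite /is_matching.
  rewrite (trivIsetS _ tM) ?subsetUr // andbT.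
  apply/subsetP=> f fM; have fe : f \in e |: M by rewrite inE fM orbT.
  have fH := subsetP sM _ fe; apply: (edges_subset fH).
  rewrite KE subsetD (edge_sub fH) /=; apply: tM' => //; rewrite ?inE ?eqxx //.
  by apply: contraNneq e'M => <-.
have eM : e \notin M.
  apply: contraTN uH => /(subsetP (proj1 (andP mM)))/edge_sub/subsetP/(_ u).
  by rewrite KE !inE eqxx => /(_ isT).
have [sM tM] := andP mM.
rewrite setU1K // eqxx andbT /is_matching subUset sub1set eE /=.
rewrite (subset_trans sM) ?edgesS ?KE ?subsetDl //=.
apply: (trivIsetU1 _ tM _).1 => [f fM|]; last first.
  by apply: contraT => /negPn/(subsetP sM)/card_edge; rewrite cards0.
have /edge_sub := subsetP sM _ fM; rewrite KE subsetD => /andP[_].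
by rewrite disjoint_sym.
Qed.

(** Matchings that miss [u] give the first term; each of the others has a unique edge at [u], whose
    removal accounts for the sign. *)
Lemma matching_poly_rec H u : u \in H -> matching_poly R H =
  'X * matching_poly R (H :\ u)
  - \sum_(y in H :\ u | adj u y) matching_poly R (H :\ u :\ y).
Proof.
move=> uH; rewrite matching_polyE (bigID (fun M => u \notin cover M)) /=.
congr (_ + _).
  rewrite (eq_bigl (is_matching (H :\ u))) => [|M]; last exact: matching_del.
  rewrite matching_polyE mulr_sumr; apply: eq_bigr => M /matching_card.
  rewrite (cardsD1 u H) uH => cM; rewrite -scalerAr -exprS; congr (_ *: 'X^_).
  rewrite add1n subSn 1?mulnC //.
pose F M : {poly R} := (-1) ^+ #|M| *: 'X^(#|H| - 2 * #|M|).
(* The edges of [M] are disjoint, so the inner sum has exactly one term when [M] covers [u] and none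
   otherwise. *)
transitivity (\sum_(M | is_matching H M)
   \sum_(y in H :\ u | adj u y && ([set u; y] \in M)) F M).
  rewrite big_mkcondr; apply: eq_bigr => M mM; rewrite negbK.
  have [sM tM] := andP mM; have /trivIsetP tM' := tM.
  case: ifPn => [/bigcupP[e eM ue]|ucov]; last first.
    rewrite big_pred0 // => y; apply: contraNF ucov => /and3P[_ _ uyM].
    by apply/bigcupP; exists [set u; y]; rewrite ?set21.
  have [y [yH uy eE]] : exists y, [/\ y \in H, adj u y & e = [set u; y]].
    have /edgesP[a [b [aH bH ab eE]]] := subsetP sM _ eM.
    move: ue; rewrite eE => /set2P[]ua; first by exists b; rewrite ua.
    by exists a; rewrite ua adj_sym setUC.
  rewrite (big_pred1 y) // => z; rewrite !inE /=.
  apply/idP/eqP=> [/and3P[/andP[zu zH] uz uzM]|->]; last first.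
    by rewrite eq_sym adj_neq ?yH ?uy //= -eE.
  apply/eqP; apply: contraT => zy.
  have neq : e != [set u; z].
    apply: contraNneq zy => ez; have : z \in e by rewrite ez set22.
    by rewrite eE !inE (negPf zu).
  have := tM' _ _ eM uzM neq.
  by rewrite disjoints_subset => /subsetP/(_ u ue); rewrite !inE eqxx.
rewrite (exchange_big_dep (fun y => (y \in H :\ u) && adj u y)) /=; last first.
  by move=> M y _ /and3P[-> ->].
rewrite -sumrN; apply: eq_bigr => y /andP[]; rewrite !inE => /andP[yu yH] uy.
pose e := [set u; y].
rewrite (reindex_onto (fun M => e |: M) (fun M => M :\ e)) /=; last first.
  by move=> M /and4P[_ _ _ eM]; rewrite setD1K.
rewrite matching_polyE -sumrN; apply: eq_big => [M|M].
  by rewrite yu yH uy setU11 /= andbT -matching_addE.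
rewrite yu yH uy setU11 /= andbT.
case/andP=> [mM /eqP eM]; rewrite /F.
have e'M : e \notin M by rewrite -eM !inE eqxx.
rewrite cardsU1 e'M exprS mulN1r scaleNr; congr (- (_ *: 'X^_)).
have := cardsD1 u H; have := cardsD1 y (H :\ u).
by rewrite uH !inE yu yH /= => -> ->; lia.
Qed.

End MatchingRecurrence.

(** * Sums of squares and the Heilmann-Lieb identity *)

Section SumsOfSquares.
Variables (R : realType) (theta : R).
Implicit Types (p q : {poly R}) (s : seq {poly R}).
Local Notation t := ('X - theta%:P).

Definition sos q := exists s, q = \sum_(p <- s) p ^+ 2.

Lemma sos0 : sos 0.
Proof. by exists [::]; rewrite big_nil. Qed.

Lemma sos_sqr p : sos (p ^+ 2).
Proof. by exists [:: p]; rewrite big_seq1. Qed.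

Lemma sosD p q : sos p -> sos q -> sos (p + q).
Proof. by move=> [s ->] [s' ->]; exists (s ++ s'); rewrite big_cat. Qed.

Lemma sos_sum (I : finType) (P : pred I) (F : I -> {poly R}) :
  (forall i, P i -> sos (F i)) -> sos (\sum_(i | P i) F i).
Proof. by move=> sosF; apply: big_ind => //; [exact: sos0 | exact: sosD]. Qed.

(** Once [t ^+ i] is factored out of every [p], the squares of the cofactors sum to 0 at [theta];
    being real, each cofactor vanishes there, which gives one more factor [t]. *)
Lemma dvdp_sum_sqr s j : t ^+ (2 * j).+1 %| \sum_(p <- s) p ^+ 2 ->
  {in s, forall p, t ^+ j.+1 %| p}.
Proof.
move=> tS; suff: forall i, (i <= j.+1)%N -> {in s, forall p, t ^+ i %| p}.
  exact.
elim=> [_ p _|i IHi lij]; first by rewrite expr0 dvd1p.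
have {}IHi := IHi (ltnW lij); pose r p := p %/ t ^+ i.
have rK p : p \in s -> p = r p * t ^+ i by move/IHi => ?; rewrite /r divpK.
have rooti : root (\sum_(p <- s) r p ^+ 2) theta.
  rewrite -dvdp_XsubCl; have: t ^+ (2 * i).+1 %| \sum_(p <- s) p ^+ 2.
    by apply: dvdp_trans tS; apply: dvdp_exp2l; lia.
  rewrite (eq_big_seq (fun p => r p ^+ 2 * t ^+ (2 * i))) => [|p /rK {1}->].
    by rewrite -mulr_suml dvdp_exp_sub ?polyXsubC_eq0 // subSnn expr1.
  by rewrite exprMn -exprM mulnC.
move=> p ps; rewrite (rK p ps) exprSr mulrC dvdp_mul // dvdp_XsubCl.
move: rooti; rewrite rootE horner_sum big_seq psumr_eq0 => [|q _].
  move/allP/(_ p ps); rewrite ps hornerE expf_eq0 //=.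
by rewrite !hornerE sqr_ge0.
Qed.

Lemma sos_dvd_even q j : sos q -> t ^+ (2 * j).+1 %| q -> t ^+ (2 * j).+2 %| q.
Proof.
case=> s -> /dvdp_sum_sqr tj; rewrite big_seq.
apply: (big_ind (fun z => _ %| z)) => [|x y|p /tj tp].
- exact: dvdp0.
- exact: dvdp_add.
by have := dvdp_mul tp tp; rewrite -exprD -expr2; congr (_ ^+ _ %| _); lia.
Qed.

Lemma sqr_sos_dvd p q j :
  sos q -> t ^+ (2 * j).+1 %| p ^+ 2 + q -> t ^+ j.+1 %| p.
Proof.
case=> s -> tpq; apply: (@dvdp_sum_sqr (p :: s)); last exact: mem_head.
by rewrite big_cons.
Qed.

(** Squares cannot cancel, so the order of vanishing of a sum bounds that of each part. *)
Lemma sosD_dvd p q j : sos p -> sos q -> t ^+ (2 * j).+1 %| p + q ->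
  t ^+ (2 * j).+2 %| p.
Proof.
case=> s -> [s' ->]; rewrite -big_cat => /dvdp_sum_sqr tj; rewrite big_seq.
apply: (big_ind (fun z => _ %| z)) => [|x y|x xs].
- exact: dvdp0.
- exact: dvdp_add.
have tx : t ^+ j.+1 %| x by apply: tj; rewrite mem_cat xs.
by have := dvdp_mul tx tx; rewrite -exprD -expr2; congr (_ ^+ _ %| _); lia.
Qed.

End SumsOfSquares.

(** * Path expansion of the Heilmann-Lieb difference *)

Section HeilmannLieb.
Variables (G : sgraph) (R : realType).
Implicit Types (H : {set G}) (u v b y : G) (w : G -> {poly R}).
Implicit Types (M : {set G} -> {poly R}).

(** The recurrence of the multivariate matching polynomial with variable [w u] at [u]. General
    weights are allowed so that it also covers [shifted_poly]. *)
Definition vertex_rec w M := forall H u, u \in H ->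
  M H = w u * M (H :\ u) - \sum_(y in H :\ u | adj u y) M (H :\ u :\ y).

(* Unfolding hl_rec shows that this is the sum of M (H \ P)^2 over all paths P
   from u to v. *)
Definition hl M H u v := M (H :\ u) * M (H :\ v) - M H * M (H :\ u :\ v).

Lemma setD1AC H u v : H :\ u :\ v = H :\ v :\ u.
Proof. by rewrite !setDDl setUC. Qed.

(** Expanding [M H] and [M (H :\ v)] at [u] makes the terms in [w u] cancel. What remains is sorted
    by the second vertex [y] of a path from [u] to [v]. *)
Lemma hl_rec w M H u v : vertex_rec w M -> u \in H -> v \in H -> u != v ->
  hl M H u v = \sum_(y in H :\ u | adj u y)
    (if y == v then M (H :\ u :\ v) ^+ 2 else hl M (H :\ u) y v).
Proof.
move=> recM uH vH uv.
have uHv : u \in H :\ v by rewrite !inE uv.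
rewrite /hl (recM _ _ uH) (recM _ _ uHv) -(setD1AC H u v).
set a := M (H :\ u); set b := M (H :\ u :\ v).
have -> : \sum_(y in H :\ u :\ v | adj u y) M (H :\ u :\ v :\ y) =
    \sum_(y in H :\ u | adj u y) (if y == v then 0 else M (H :\ u :\ y :\ v)).
  rewrite [RHS](bigID (pred1 v)) /= [X in _ = X + _]big1 ?add0r; last first.
    by move=> y /andP[_ /eqP->]; rewrite eqxx.
  apply: eq_big => [y|y /andP[]]; rewrite !inE.
    by case: (y == v); rewrite ?andbF ?andbT.
  by case/and3P=> /negPf-> _ _ _; rewrite setD1AC.
rewrite [RHS](eq_bigr (fun y => M (H :\ u :\ y) * b -
    a * (if y == v then 0 else M (H :\ u :\ y :\ v)))) => [|y _]; last first.
  by case: eqP => [->|_]; first rewrite mulr0 subr0 expr2.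
by rewrite sumrB -mulr_suml -mulr_sumr; ring.
Qed.

Lemma hl_sos w M H u v : vertex_rec w M -> u \in H -> v \in H -> u != v ->
  sos (hl M H u v).
Proof.
move=> recM; have [n] := ubnP #|H|; elim: n H u => // n IHn H u ltHn uH vH uv.
rewrite (hl_rec recM) //; apply: sos_sum => y /andP[yH _].
case: eqP => [_|/eqP yv]; first exact: sos_sqr.
apply: IHn => //; last by rewrite !inE eq_sym uv.
by move: ltHn; rewrite (cardsD1 u H) uH.
Qed.

(** The square kept apart is the term of the one-edge path from [u] to [v]. *)
Lemma hl_adj w M H u v : vertex_rec w M -> u \in H -> v \in H -> adj u v ->
  exists2 q, sos q & hl M H u v = M (H :\ u :\ v) ^+ 2 + q.
Proof.
move=> recM uH vH uv; have uv' := adj_neq uv.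
eexists; last first.
  rewrite (hl_rec recM) // (bigD1 v) /= ?eqxx //.
  by rewrite !inE eq_sym uv' vH.
apply: sos_sum => y /andP[/andP[yH uy] yv].
rewrite (negPf yv); apply: (hl_sos recM) => //.
by rewrite !inE eq_sym uv'.
Qed.

(** The difference kept apart collects the paths from [u] to [v] whose first edge is [u y]. *)
Lemma hl_step w M H u y v : vertex_rec w M ->
  u \in H -> y \in H -> v \in H -> adj u y -> u != v -> y != v ->
  exists2 q, sos q & hl M H u v = hl M (H :\ u) y v + q.
Proof.
move=> recM uH yH vH uy uv yv; have uy' := adj_neq uy.
eexists; last first.
  rewrite (hl_rec recM) // (bigD1 y) /= ?(negPf yv) //.
  by rewrite !inE eq_sym uy' yH.
apply: sos_sum => z /andP[/andP[zH uz] zy].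
case: eqP => [_|/eqP zv]; first exact: sos_sqr.
by apply: (hl_sos recM) => //; rewrite !inE eq_sym uv.
Qed.

Local Notation mu := (matching_poly R).

Lemma matching_poly_vertex_rec : vertex_rec (fun=> 'X) (@matching_poly G R).
Proof. by move=> H u uH; exact: matching_poly_rec. Qed.

(* Raising the variable of the single vertex b from X to X + 1 in the
   multivariate matching polynomial turns mu H into mu H + mu (H \ b). *)
Definition shifted_poly b H := mu H + (if b \in H then mu (H :\ b) else 0).

(** At [u = b] the extra 1 in the weight supplies [mu (H :\ b)]; at any other [u] the recurrences of
    [H] and, if [b] is in [H], of [H :\ b] are added. *)
Lemma shifted_vertex_rec b :
  vertex_rec (fun u => 'X + (u == b)%:R) (shifted_poly b).
Proof.
move=> H u uH; rewrite /shifted_poly (matching_poly_rec _ uH) big_split /=.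
rewrite (in_setD1 b) [b == u]eq_sym.
case: (eqVneq u b) => [<-|ub] /=.
  rewrite uH ?eqxx [X in _ - (_ + X)]big1 => [|y _]; first by ring.
  by rewrite !inE eqxx andbF.
case: ifP => bH; last first.
  rewrite [X in _ - (_ + X)]big1 => [|y _]; first by ring.
  by rewrite !inE bH !andbF.
have uHb : u \in H :\ b by rewrite !inE ub.
rewrite (matching_poly_rec _ uHb) -(setD1AC H u b).
have -> : \sum_(y in H :\ u :\ b | adj u y) mu (H :\ u :\ b :\ y) =
  \sum_(y in H :\ u | adj u y)
    (if b \in H :\ u :\ y then mu (H :\ u :\ y :\ b) else 0).
  rewrite [RHS](bigID (pred1 b)) /= [X in _ = X + _]big1 ?add0r; last first.
    by move=> y /andP[_ /eqP->]; rewrite !inE eqxx.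
  apply: eq_big => [y|y /andP[]]; rewrite !inE.
    by case: (y == b); rewrite ?andbF ?andbT.
  case/and3P=> yb _ _ _.
  by rewrite eq_sym (negPf yb) [b == u]eq_sym ub bH setD1AC.
by ring.
Qed.

End HeilmannLieb.

(** * Multiplicities *)

(* lia case-splits on every boolean hypothesis in sight, so keep only the
   inequalities. *)
Ltac nlia :=
  repeat match goal with
  | h : is_true (leq _ _) |- _ => revert h
  end;
  repeat match goal with
  | h : is_true _ |- _ => clear h
  end;
  lia.

Section Multiplicity.
Variables (G : sgraph) (R : realType) (theta : R).
Implicit Types (A B C D H K S X : {set G}) (Q : {set {set G}}) (a b u v y : G).
Local Notation mu := (matching_poly R).
Local Notation mlt := (mult theta).
Local Notation t := ('X - theta%:P).

Lemma matching_poly_neq0 H : mu H != 0.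
Proof.
suff: (mu H)`_#|H| != 0 by apply: contraNneq => ->; rewrite coef0.
rewrite matching_polyE coef_sum (bigD1 set0) /=; last first.
  by rewrite /is_matching sub0set; apply/trivIsetP=> A B; rewrite inE.
rewrite cards0 muln0 subn0 expr0 scale1r coefXn eqxx big1 ?addr0 ?oner_neq0 //.
move=> M /andP[/matching_card cM M0]; rewrite coefZ coefXn.
have : (0 < #|M|)%N by rewrite card_gt0.
case: eqP => [eqH M_gt0|_ _]; rewrite ?mulr0 //; exfalso.
have {}eqH : #|H| = (#|H| - 2 * #|M|)%N := eqH.
lia.
Qed.

Lemma mult_geq n H : (t ^+ n %| mu H) = (n <= mlt H)%N.
Proof. by rewrite -mup_geq ?matching_poly_neq0. Qed.

Lemma multM_geq n H K : (t ^+ n %| mu H * mu K) = (n <= mlt H + mlt K)%N.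
Proof.
by rewrite -mup_geq ?mulf_neq0 ?matching_poly_neq0 // mupM ?matching_poly_neq0.
Qed.

Lemma mult_eq0 H : (mlt H == 0)%N = ~~ root (mu H) theta.
Proof. by rewrite -dvdp_XsubCl -(expr1 t) mult_geq lt0n negbK. Qed.

(** Differentiating the recurrence at [u] gives [mu (H :\ u)] and, by induction, the recurrences at
    [u] of all the other [mu (H :\ v)]. *)
Lemma deriv_matching_poly H : (mu H)^`() = \sum_(v in H) mu (H :\ v).
Proof.
have [n] := ubnP #|H|; elim: n H => // n IHn H ltHn.
have [->|[u uH]] := set_0Vmem H.
  by rewrite big_set0 matching_poly0 -polyC1 derivC.
have ltHu : (#|H :\ u| < n)%N by move: ltHn; rewrite (cardsD1 u H) uH.
rewrite (matching_poly_rec _ uH) derivB derivM derivX mul1r IHn // raddf_sum /=.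
rewrite [RHS](bigD1 u) //= -addrA; congr (_ + _).
have -> : \sum_(y in H :\ u | adj u y) (mu (H :\ u :\ y))^`() =
    \sum_(v in H :\ u) \sum_(y in H :\ u | adj u y && (v != y))
       mu (H :\ u :\ v :\ y).
  rewrite (exchange_big_dep (fun y => (y \in H :\ u) && adj u y)) /=; last first.
    by move=> v y _ /and3P[-> ->].
  apply: eq_bigr => y /andP[yHu uy]; rewrite IHn; last first.
    by apply: leq_ltn_trans ltHu; rewrite subset_leq_card ?subD1set.
  apply: eq_big => [v|v _]; last by rewrite setD1AC.
  by rewrite yHu uy in_setD1 andbC.
rewrite mulr_sumr -sumrB; apply: eq_big => [v|v vHu].
  by rewrite in_setD1 andbC.
have uHv : u \in H :\ v by move: vHu; rewrite !inE eq_sym uH => /andP[->].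
rewrite (matching_poly_rec _ uHv) (setD1AC H v u); congr (_ - _).
apply: eq_bigl => y; rewrite !inE [v == y]eq_sym.
by case: (y == v); case: (y == u); rewrite ?andbF ?andbT.
Qed.

Lemma dvdp_deriv_exp n (p : {poly R}) : t ^+ n %| p -> t ^+ n.-1 %| p^`().
Proof.
move=> /divpK <-; rewrite derivM; apply: dvdp_add; apply: dvdp_mull.
  exact: dvdp_exp2l (leq_pred n).
by rewrite deriv_exp derivXsubC mul1r -mulr_natr dvdp_mulr.
Qed.

(** The Wronskian of [mu H] and [mu (H :\ u)] is [mu (H :\ u) ^+ 2] plus a sum of squares. If the
    multiplicity fell from at least l+2 to l, its order would be at least 2l+1, forcing order l+1 on
    [mu (H :\ u)]. *)
Lemma interlace_le H u : u \in H -> (mlt H <= (mlt (H :\ u)).+1)%N.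
Proof.
move=> uH; rewrite leqNgt; apply/negP => mltH; set l := mlt (H :\ u) in mltH.
have hlE : mu (H :\ u) * (mu H)^`() - mu H * (mu (H :\ u))^`() =
    mu (H :\ u) ^+ 2 + \sum_(v in H :\ u) hl (@matching_poly G R) H u v.
  rewrite !deriv_matching_poly (bigD1 u) //= /hl sumrB -!mulr_sumr.
  rewrite (eq_bigl (fun v => v \in H :\ u)) => [|v]; first by ring.
  by rewrite in_setD1 andbC.
have hl_gt : sos (\sum_(v in H :\ u) hl (@matching_poly G R) H u v).
  apply: sos_sum => v; rewrite !inE => /andP[vu vH].
  by apply: (hl_sos (@matching_poly_vertex_rec _ _)) => //; rewrite eq_sym.
suff: t ^+ l.+1 %| mu (H :\ u) by rewrite mult_geq ltnn.
apply: (sqr_sos_dvd hl_gt); rewrite -hlE; apply: dvdp_sub.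
  apply: (@dvdp_trans _ (t ^+ l * t ^+ l.+1)).
    by rewrite -exprD; apply: dvdp_exp2l; lia.
  apply: dvdp_mul; first by rewrite mult_geq.
  by apply: (@dvdp_deriv_exp l.+2); rewrite mult_geq.
apply: (@dvdp_trans _ (t ^+ l.+2 * t ^+ l.-1)).
  by rewrite -exprD; apply: dvdp_exp2l; lia.
by apply: dvdp_mul; [|apply: dvdp_deriv_exp]; rewrite mult_geq.
Qed.

(** In the recurrence at [u], each [mu (H :\ u :\ y)] loses at most one from the multiplicity of
    [H :\ u], by [interlace_le]. *)
Lemma interlace_ge H u : u \in H -> (mlt (H :\ u) <= (mlt H).+1)%N.
Proof.
move=> uH; rewrite -ltnS; case mltHu: (mlt (H :\ u)) => [|l] //.
rewrite !ltnS -mult_geq (matching_poly_rec _ uH); apply: dvdp_sub.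
  by apply: dvdp_mull; rewrite mult_geq mltHu.
apply: (big_ind (fun z => _ %| z)) => [|x y|y /andP[yHu _]].
- exact: dvdp0.
- exact: dvdp_add.
by rewrite mult_geq -ltnS -mltHu interlace_le.
Qed.

Lemma essentialP H u :
  reflect ((mlt (H :\ u)).+1 = mlt H) (essential theta H u).
Proof. exact: eqP. Qed.

Lemma essentialN H u :
  u \in H -> ~~ essential theta H u = (mlt H <= mlt (H :\ u))%N.
Proof. by move=> /interlace_le; rewrite /essential; lia. Qed.

Lemma interlace_ge_setD H S : S \subset H -> (mlt (H :\: S) <= mlt H + #|S|)%N.
Proof.
have [n] := ubnP #|S|; elim: n S => // n IHn S ltSn sSH.
have [->|[x xS]] := set_0Vmem S; first by rewrite cards0 addn0 setD0.
have ltS' : (#|S :\ x| < n)%N by move: ltSn; rewrite (cardsD1 x S) xS.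
have -> : H :\: S = (H :\: (S :\ x)) :\ x by rewrite setDDl setUC setD1K.
have := IHn _ ltS' (subset_trans (subD1set _ _) sSH).
rewrite (cardsD1 x S) xS; set K := H :\: _.
have xK : x \in K by rewrite !inE eqxx (subsetP sSH).
by have := interlace_ge xK; lia.
Qed.

(** Otherwise every [mu (H :\ u)], hence their sum, the derivative of [mu H], would vanish to the
    full order of [mu H], which is impossible in characteristic 0. *)
Lemma essential_exists H : (0 < mlt H)%N ->
  exists2 u, u \in H & essential theta H u.
Proof.
move=> H_gt0; have [/existsP[u /andP[uH uess]]|] :=
  boolP [exists u in H, essential theta H u]; first by exists u.
rewrite negb_exists => /forallP noess; exfalso.
have [k mltH] : exists k, mlt H = k.+1 by exists (mlt H).-1; rewrite prednK.
have [q muE] : exists q, mu H = q * t ^+ k.+1.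
  by apply/dvdpP; rewrite mult_geq mltH.
have tk : t ^+ k.+1 %| (mu H)^`().
  rewrite deriv_matching_poly.
  apply: (big_ind (fun z => _ %| z)) => [|x y|u uH].
  - exact: dvdp0.
  - exact: dvdp_add.
  by rewrite mult_geq -mltH -essentialN //; have := noess u; rewrite uH.
suff: t ^+ k.+2 %| mu H by rewrite mult_geq mltH ltnn.
rewrite muE exprS; apply: dvdp_mul; last exact: dvdpp.
move: tk; rewrite muE derivM (dvdp_addr _ (dvdp_mull _ (dvdpp _))).
rewrite deriv_exp derivXsubC mul1r mulrnAr -scaler_nat.
rewrite dvdpZr ?pnatr_eq0 // dvdp_exp_sub ?polyXsubC_eq0 //.
by rewrite subSnn expr1.
Qed.

(** * Parity arguments for essential and positive vertices *)

Local Notation hlmu := (hl (@matching_poly G R)).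
Let mu_rec := @matching_poly_vertex_rec G R.

Lemma multM_dvd_subr H1 K1 H2 K2 n :
  (n <= mlt H2 + mlt K2)%N -> t ^+ n %| mu H1 * mu K1 - mu H2 * mu K2 ->
  (n <= mlt H1 + mlt K1)%N.
Proof. by rewrite -!multM_geq => t2; rewrite dvdp_subl. Qed.

Lemma multM_dvd_subl H1 K1 H2 K2 n :
  (n <= mlt H1 + mlt K1)%N -> t ^+ n %| mu H1 * mu K1 - mu H2 * mu K2 ->
  (n <= mlt H2 + mlt K2)%N.
Proof. by rewrite -!multM_geq => t2; rewrite dvdp_subr. Qed.

(** Let m be [mlt H]. The difference at [a], [b] has order at least 2m-1, hence 2m by parity, and
    its square part gives [mu (H :\ a :\ b)] order m. So [mu (H :\ a) * mu (H :\ b)] has order at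
    least 2m, of which [b] supplies only m-1. *)
Lemma positive_of_adj_essential H a b : a \in H -> b \in H -> adj a b ->
  essential theta H b -> ~~ essential theta H a -> positive theta H a.
Proof.
move=> aH bH ab /eqP eb; rewrite (essentialN aH) => na; rewrite /positive.
have ia := interlace_ge aH; rewrite eqn_leq ia /=.
have [q sq hlE] := hl_adj mu_rec aH bH ab.
have bHa : b \in H :\ a by rewrite !inE eq_sym adj_neq.
have iab := interlace_le bHa.
have t1 : t ^+ (2 * mlt (H :\ b)).+1 %| hlmu H a b.
  by apply: dvdp_sub; rewrite multM_geq; nlia.
rewrite hlE in t1; have := sqr_sos_dvd sq t1; rewrite mult_geq => mab.
rewrite -hlE in t1.
have := sos_dvd_even (hl_sos mu_rec aH bH (adj_neq ab)) t1.
by move/multM_dvd_subr; nlia.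
Qed.

(** The difference has order at least 2 [mlt H] - 2, and the square of [mu (H :\ a :\ b)] is one of
    its summands. Thus [b] is no longer essential once [a] is deleted. *)
Lemma adj_essential_pair H a b : a \in H -> b \in H -> adj a b ->
  essential theta H a -> essential theta H b ->
  (mlt H <= (mlt (H :\ a :\ b)).+1)%N.
Proof.
move=> aH bH ab /essentialP ea /eqP eb.
have [q sq hlE] := hl_adj mu_rec aH bH ab.
have bHa : b \in H :\ a by rewrite !inE eq_sym adj_neq.
have iab := interlace_le bHa.
case m1: (mlt (H :\ a)) => [|j]; first nlia.
suff: (t ^+ j.+1 %| mu (H :\ a :\ b)) by rewrite mult_geq; nlia.
apply: (sqr_sos_dvd sq); rewrite -hlE.
by apply: dvdp_sub; rewrite multM_geq; nlia.
Qed.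

(* The Heilmann-Lieb sums for H and H \ b, and the one for the polynomials
   shifted at b, have even order at theta; the last one is A + B + C. *)
Lemma hl_cross_dvd H b u v j : b \in H -> u \in H -> v \in H ->
  u != v -> b != u -> b != v ->
  let A := mu (H :\ u) * mu (H :\ v) - mu H * mu (H :\ u :\ v) in
  let B := mu (H :\ u :\ b) * mu (H :\ v :\ b)
           - mu (H :\ b) * mu (H :\ u :\ v :\ b) in
  let C := mu (H :\ u) * mu (H :\ v :\ b) + mu (H :\ u :\ b) * mu (H :\ v)
           - mu H * mu (H :\ u :\ v :\ b) - mu (H :\ b) * mu (H :\ u :\ v) in
  t ^+ (2 * j).+1 %| A -> t ^+ (2 * j).+1 %| B -> t ^+ (2 * j).+1 %| C ->
  t ^+ (2 * j).+2 %| C.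
Proof.
move=> bH uH vH uv bu bv A B C tA tB tC.
have sA : sos A by apply: (hl_sos mu_rec uH).
have sB : sos B.
  rewrite /B -!(setD1AC _ b); apply: (hl_sos mu_rec) => //.
    by rewrite !inE eq_sym bu.
  by rewrite !inE eq_sym bv.
have sABC : sos (A + B + C).
  have := hl_sos (@shifted_vertex_rec G R b) uH vH uv; congr sos.
  rewrite /hl /shifted_poly !inE bH bu bv /= /A /B /C; ring.
have := sos_dvd_even sABC (dvdp_add (dvdp_add tA tB) tC).
by rewrite dvdp_addr // dvdp_add // sos_dvd_even.
Qed.

(** The cross term C is made of four products; if three have order at least 2j+2, then so does C
    minus the fourth, and parity of C transfers this to the fourth. *)
Lemma cross_mult H b u v j : b \in H -> u \in H -> v \in H ->
  u != v -> b != u -> b != v ->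
  (2 * j < mlt (H :\ u) + mlt (H :\ v))%N ->
  (2 * j < mlt H + mlt (H :\ u :\ v))%N ->
  (2 * j < mlt (H :\ u :\ b) + mlt (H :\ v :\ b))%N ->
  (2 * j < mlt (H :\ b) + mlt (H :\ u :\ v :\ b))%N ->
  (2 * j < mlt (H :\ u) + mlt (H :\ v :\ b))%N ->
  ((2 * j).+1 < mlt (H :\ u :\ b) + mlt (H :\ v))%N ->
  ((2 * j).+1 < mlt H + mlt (H :\ u :\ v :\ b))%N ->
  ((2 * j).+1 < mlt (H :\ b) + mlt (H :\ u :\ v))%N ->
  ((2 * j).+1 < mlt (H :\ u) + mlt (H :\ v :\ b))%N.
Proof.
move=> bH uH vH uv bu bv m1 m2 m3 m4 m5 m6 m7 m8.
have := @hl_cross_dvd H b u v j bH uH vH uv bu bv; rewrite /=.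
do 2 ![rewrite dvdp_sub ?multM_geq // => /(_ isT)].
rewrite dvdp_sub ?multM_geq ?(ltnW m8) //; last first.
  rewrite dvdp_sub ?multM_geq ?(ltnW m7) //.
  by rewrite dvdp_add ?multM_geq ?(ltnW m6).
move=> /(_ isT).
by rewrite !(dvdp_subl, dvdp_addl) ?multM_geq.
Qed.

(** This carries [adj_essential_pair] along walks. If it failed, with n = [mlt H] - 2, one cross
    product would have order exactly 2n+1 while the other three have order at least 2n+2. *)
Lemma essential_pair_trans H b u y : b \in H -> u \in H -> y \in H ->
  b != u -> u != y -> b != y ->
  essential theta H b -> essential theta H u -> essential theta H y ->
  (mlt H <= (mlt (H :\ b :\ u)).+1)%N -> (mlt H <= (mlt (H :\ u :\ y)).+1)%N ->
  (mlt H <= (mlt (H :\ b :\ y)).+1)%N.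
Proof.
move=> bH uH yH bu uy by_ /essentialP eb /essentialP eu /essentialP ey mbu muy.
have yHb : y \in H :\ b by rewrite !inE eq_sym by_.
have yHbu : y \in H :\ b :\ u by rewrite !inE eq_sym uy eq_sym by_.
have := interlace_le yHb; have := interlace_le yHbu.
have -> : H :\ b :\ u :\ y = H :\ u :\ y :\ b.
  by rewrite (setD1AC H) (setD1AC _ b).
rewrite (setD1AC H b y); rewrite (setD1AC H b u) in mbu *.
move=> mbuy mby; rewrite leqNgt; apply/negP => lt_by.
have [n nE] : exists n, mlt H = n.+2 by exists (mlt H - 2)%N; nlia.
suff: ((2 * n).+1 < mlt (H :\ u) + mlt (H :\ y :\ b))%N by nlia.
by apply: cross_mult => //; nlia.
Qed.

(* The substance of the stability lemma: deleting a special vertex creates no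
   new essential vertex. *)
Lemma special_stable H a b u : a \in H -> b \in H -> u \in H -> u != a ->
  adj a b -> essential theta H b -> ~~ essential theta H a ->
  essential theta (H :\ a) u -> essential theta H u.
Proof.
move=> aH bH uH ua ab eb na eua; apply: contraT => nu.
have /eqP mpa := positive_of_adj_essential aH bH ab eb na.
have ub : u != b by apply: contraNneq nu => ->.
have ab' := adj_neq ab.
have bHa : b \in H :\ a by rewrite !inE eq_sym ab'.
have aHb : a \in H :\ b by rewrite !inE ab'.
have bHu : b \in H :\ u by rewrite !inE eq_sym ub.
have uHb : u \in H :\ b by rewrite !inE ub.
have aHu : a \in H :\ u by rewrite !inE eq_sym ua.
have /essentialP mb := eb; have /essentialP mau := eua.
have := nu; rewrite (essentialN uH) => mu_u.
have iu := interlace_ge uH.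
have iab := interlace_le bHa; have := interlace_ge aHb.
rewrite (setD1AC H b a) => iba.
have ibu := interlace_le bHu; have := interlace_ge uHb.
rewrite (setD1AC H b u) => iub.
(* If [u] is neutral in [H]: should [b] be essential in [H :\ u], then [a] would be positive there,
   against [eua]; otherwise the difference at [b], [u] would have odd order. *)
have [uE|uE] : mlt (H :\ u) = mlt H \/ mlt (H :\ u) = (mlt H).+1 by nlia.
  have [ebu|nbu] := boolP (essential theta (H :\ u) b).
    suff /eqP : positive theta (H :\ u) a by rewrite (setD1AC H u a); nlia.
    apply: positive_of_adj_essential ebu _ => //.
    by rewrite (essentialN aHu) (setD1AC H u a); nlia.
  move: nbu; rewrite (essentialN bHu) => mbu.
  have [j jE] : exists j, mlt H = j.+1 by exists (mlt H).-1; nlia.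
  have tj : t ^+ (2 * j).+1 %| hlmu H b u.
    by apply: dvdp_sub; rewrite multM_geq ?(setD1AC H b u); nlia.
  have := sos_dvd_even (hl_sos mu_rec bH uH _) tj; rewrite eq_sym => /(_ ub).
  by move/multM_dvd_subr; rewrite (setD1AC H b u); nlia.
have [j jE] : exists j, mlt H = j.+1 by exists (mlt H).-1; nlia.
(* If [u] is positive in [H], the paths from [b] to [u] through the edge [b a] already have total
   order at least 2 [mlt H]; this makes [mu (H :\ u :\ b :\ a)] vanish to order above [mlt H]. *)
have [q sq hlE] : exists2 q, sos q & hlmu H b u = hlmu (H :\ b) a u + q.
  by apply: (hl_step mu_rec) => //; rewrite 1?adj_sym // eq_sym.
have tbu : t ^+ (2 * j).+1 %| hlmu H b u.
  by apply: dvdp_sub; rewrite multM_geq ?(setD1AC H b u); nlia.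
have : t ^+ (2 * j).+2 %| hlmu (H :\ b) a u.
  rewrite hlE in tbu; apply: sosD_dvd tbu => //.
  by apply: (hl_sos mu_rec) => //; rewrite eq_sym.
rewrite /hl (setD1AC H b a) (setD1AC H b u).
have -> : H :\ a :\ b :\ u = H :\ u :\ b :\ a.
  by rewrite (setD1AC _ b u) (setD1AC H a u) (setD1AC _ a b).
move=> /multM_dvd_subl mabu.
have {}mabu : (mlt H < mlt (H :\ u :\ b :\ a))%N.
  have /mabu : ((2 * j).+2 <= mlt (H :\ a :\ b) + mlt (H :\ u :\ b))%N by nlia.
  by nlia.
(* By [mb], [mpa] and [eua] this sum equals 2j+1, so the cross-term bound is the contradiction. *)
have : ((2 * j).+1 < mlt (H :\ b) + mlt (H :\ u :\ a))%N.
  apply: cross_mult => //; rewrite 1?eq_sym //;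
    by rewrite ?(setD1AC H u a) ?(setD1AC H b a) ?(setD1AC H b u); nlia.
by rewrite (setD1AC H u a); nlia.
Qed.

(** * Critical components and barriers *)

Lemma connect_adj_in_sym H : connect_sym (adj_in H).
Proof.
by apply: sym_connect_sym => u v; rewrite /adj_in adj_sym andbCA.
Qed.

(** Adjacency and transitivity of pairs show that no vertex of [H :\ u] is essential there, so its
    multiplicity is 0. *)
Lemma gallai H u : u \in H -> connected H ->
  {in H, forall v, essential theta H v} -> critical theta H.
Proof.
move=> uH conH essH; apply/andP; split.
  by apply/forall_inP => v /essH.
have pairs y : y \in H -> y != u -> (mlt H <= (mlt (H :\ u :\ y)).+1)%N.
  pose S := [pred y | (y == u) || (mlt H <= (mlt (H :\ u :\ y)).+1)%N].
  have closedS : closed (adj_in H) S.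
    apply: intro_closed; first exact: connect_adj_in_sym.
    move=> v z /and3P[vH zH vz]; rewrite !inE => Sv.
    case: (eqVneq z u) => //= zu.
    case: (eqVneq v u) Sv vz vH => [-> _|vu /= mv] vz vH.
      by apply: adj_essential_pair; rewrite ?essH.
    have mvz := adj_essential_pair vH zH vz (essH _ vH) (essH _ zH).
    by apply: (essential_pair_trans uH vH zH _ (adj_neq vz)) mv mvz;
      rewrite ?essH // eq_sym.
  move=> yH yu; have /forall_inP/(_ u uH)/forall_inP/(_ y yH) := conH.
  move/(closed_connect closedS); rewrite !inE eqxx /= (negPf yu) /=.
  by move=> <-.
have /essentialP mu_ := essH u uH.
rewrite -mu_ eqSS; apply/negPn; rewrite -lt0n; apply/negP.
case/essential_exists=> y; rewrite !inE => /andP[yu yH] /essentialP my.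
by have := pairs y yH yu; nlia.
Qed.

(** * Disjoint unions and expansion along a set *)

Lemma matching_polyU A B : [disjoint A & B] ->
  {in A & B, forall u v, ~~ adj u v} -> mu (A :|: B) = mu A * mu B.
Proof.
have [n] := ubnP #|A|; elim: n A => // n IHn A ltAn dAB nAB.
have [->|[u uA]] := set_0Vmem A; first by rewrite set0U matching_poly0 mul1r.
have uB : u \notin B by rewrite (disjointFr dAB).
have delU C v : C \subset A -> v \in C -> (C :|: B) :\ v = (C :\ v) :|: B.
  move=> /subsetP sCA /sCA vA; rewrite setDUl; congr (_ :|: _).
  by apply/setDidPl; rewrite disjoint_sym disjoints1 (disjointFr dAB).
have IH C : C \proper A -> mu (C :|: B) = mu C * mu B.
  move=> pCA; have sCA := proper_sub pCA; apply: IHn.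
  - exact: leq_trans (proper_card pCA) ltAn.
  - exact: disjointWl dAB.
  - by move=> x y /(subsetP sCA); exact: nAB.
have pA : A :\ u \proper A by rewrite properD1.
rewrite (matching_poly_rec _ uA).
rewrite (@matching_poly_rec _ _ (A :|: B) u) ?inE ?uA //.
rewrite delU // IH // mulrBl mulrA; congr (_ - _); rewrite mulr_suml.
apply: eq_big => [y|y /andP[yAB uy]].
  rewrite !inE; case: (boolP (y \in B)) => yB; last by rewrite orbF.
  by rewrite (disjointFl dAB) // (negPf (nAB _ _ uA yB)) !andbF.
have yA : y \in A :\ u.
  move: yAB; rewrite !inE => /orP[//|yB].
  by have := nAB _ _ uA yB; rewrite uy.
rewrite delU ?subD1set // IH //.
by apply: sub_proper_trans pA; exact: subD1set.
Qed.

Lemma multU A B : [disjoint A & B] -> {in A & B, forall u v, ~~ adj u v} ->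
  mlt (A :|: B) = (mlt A + mlt B)%N.
Proof.
by move=> dAB nAB; rewrite /mult matching_polyU // mupM ?matching_poly_neq0.
Qed.

(* In the expansion along X only the terms matching X into D survive: every
   other term leaves D with multiplicity larger than the number of vertices of X
   left. *)
Lemma horner_matching_polyU X D B : [disjoint X & D] -> [disjoint X & B] ->
  [disjoint D & B] -> {in D & B, forall u v, ~~ adj u v} ->
  (#|X| <= mlt D)%N ->
  (mu (X :|: D :|: B)).[theta] = (mu (X :|: D)).[theta] * (mu B).[theta].
Proof.
have [n] := ubnP #|X|; elim: n X D => // n IHn X D ltXn dXD dXB dDB nDB leXD.
have [X0|[x xX]] := set_0Vmem X.
  by rewrite X0 !set0U matching_polyU // hornerM.
have xD : x \notin D by rewrite (disjointFr dXD).
have xB : x \notin B by rewrite (disjointFr dXB).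
have cX : #|X| = #|X :\ x|.+1 by rewrite (cardsD1 x X) xX.
(* Stated for every [B'] because it is applied both to [B] and to the empty set. *)
have expand B' : [disjoint X & B'] -> [disjoint D & B'] ->
    {in D & B', forall u v, ~~ adj u v} ->
  (mu (X :|: D :|: B')).[theta] =
  - \sum_(y in D | adj x y) (mu ((X :\ x) :|: (D :\ y) :|: B')).[theta].
  move=> dXB' dDB' nDB'.
  have xB' : x \notin B' by rewrite (disjointFr dXB').
  have delE : (X :|: D :|: B') :\ x = (X :\ x) :|: D :|: B'.
    apply/setP=> z; rewrite !inE; case: eqVneq => [->|] //=.
    by rewrite (negPf xD) (negPf xB').
  have vanish X' B'' : (#|X'| < #|X|)%N -> [disjoint D & B''] ->
      {in D & B'', forall u v, ~~ adj u v} ->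
      (mu (X' :|: D :|: B'')).[theta] = 0.
    move=> ltX' dDB'' nDB''; apply/eqP; rewrite -[_ == 0]negbK -mult_eq0 -lt0n.
    have sX' : X' :\: (D :|: B'') \subset X' :|: D :|: B''.
      by rewrite -setUA; apply: subset_trans (subsetDl _ _) (subsetUl _ _).
    have := interlace_ge_setD sX'; rewrite -setUA.
    have -> : (X' :|: (D :|: B'')) :\: (X' :\: (D :|: B'')) = D :|: B''.
      apply/setP=> z; rewrite !inE; case: (z \in X'); case: (z \in D);
        by case: (z \in B'').
    rewrite multU //.
    have := subset_leq_card (subsetDl X' (D :|: B'')); nlia.
  have xH : x \in X :|: D :|: B' by rewrite !inE xX.
  rewrite (matching_poly_rec _ xH) hornerD hornerM hornerN delE.
  rewrite vanish ?cX ?ltnSn // mulr0 sub0r; congr (- _); rewrite horner_sum.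
  rewrite (bigID (mem D)) /= [X in _ + X]big1 ?addr0; last first.
    move=> y /andP[/andP[yH _] yD].
    have -> : ((X :\ x) :|: D :|: B') :\ y =
        ((X :\ x) :\ y) :|: D :|: (B' :\ y).
      apply/setP=> z; rewrite !inE; case: eqVneq => [->|] //=.
      by rewrite (negPf yD).
    apply: vanish.
    - by rewrite cX ltnS subset_leq_card ?subD1set.
    - exact: disjointWr (subD1set _ _) dDB'.
    - by move=> a b aD; rewrite inE => /andP[_]; exact: nDB'.
  apply: eq_big => [y|y].
    rewrite !inE; case yD : (y \in D); rewrite ?andbF ?andbT //=.
    by rewrite orbT.
  move=> /andP[_ yD]; congr (_ .[_]); congr (mu _).
  apply/setP=> z; rewrite !inE; case: eqVneq => [->|] //=.
  by rewrite (disjointFl dXD) // (disjointFr dDB') ?andbF.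
have disj0 C : [disjoint C & set0] by rewrite -setI_eq0 setI0.
rewrite -[X :|: D in RHS]setU0 !expand //; last by move=> a b _; rewrite inE.
rewrite mulNr mulr_suml; congr (- _); apply: eq_bigr => y /andP[yD _].
rewrite setU0; apply: IHn.
- by move: ltXn; rewrite cX.
- exact: disjointWl (subD1set _ _) (disjointWr (subD1set _ _) dXD).
- exact: disjointWl (subD1set _ _) dXB.
- exact: disjointWl (subD1set _ _) dDB.
- by move=> a b; rewrite inE => /andP[_]; exact: nDB.
- by have := interlace_le yD; nlia.
Qed.

(** * Connected components *)

Lemma equivalence_adj_in H :
  {in H & &, equivalence_rel (connect (adj_in H))}.
Proof.
move=> x y z _ _ _; split=> [|xy]; first exact: connect0.
exact: (same_connect (@connect_adj_in_sym H)).
Qed.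

Lemma components_partition H : partition (components H) H.
Proof. exact: equivalence_partitionP (@equivalence_adj_in H). Qed.

Lemma component_sub H C : C \in components H -> C \subset H.
Proof.
move=> CH; rewrite -(cover_partition (components_partition H)).
exact: bigcup_sup CH.
Qed.

Lemma component_neq0 H C : C \in components H -> C != set0.
Proof. by apply: contraTneq => ->; have /and3P[] := components_partition H. Qed.

Lemma component_connect H C u v : C \in components H -> u \in C ->
  (v \in C) = (v \in H) && connect (adj_in H) u v.
Proof.
move=> CH uC; have uH := subsetP (component_sub CH) u uC.
have [vH|vH] /= := boolP (v \in H); last first.
  by apply: contraNF vH; exact: (subsetP (component_sub CH)).
have tI := partition_trivIset (components_partition H).
rewrite -(def_pblock tI CH uC).
by rewrite (pblock_equivalence_partition (@equivalence_adj_in H)).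
Qed.

Lemma component_adj H C u v : C \in components H -> u \in C -> v \in H ->
  adj u v -> v \in C.
Proof.
move=> CH uC vH uv; rewrite (component_connect _ CH uC) vH connect1 //.
by rewrite /adj_in vH uv (subsetP (component_sub CH)).
Qed.

Lemma connect_component H C u v : C \in components H -> u \in C ->
  connect (adj_in H) u v -> connect (adj_in C) u v.
Proof.
move=> CH uC /connectP[p pth ->]; elim: p u uC pth => [|x p IHp] u uC //=.
case/andP=> /and3P[uH xH ux] pth; have xC := component_adj CH uC xH ux.
by apply: connect_trans (IHp _ xC pth); apply: connect1; apply/and3P.
Qed.

Lemma component_connected H C : C \in components H -> connected C.
Proof.
move=> CH; apply/forall_inP => u uC; apply/forall_inP => v vC.
apply: (connect_component CH uC); move: vC.
by rewrite (component_connect _ CH uC) => /andP[].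
Qed.

Lemma componentI H C : C \subset H -> C != set0 -> connected C ->
  (forall u v, u \in C -> v \in H -> adj u v -> v \in C) -> C \in components H.
Proof.
move=> /subsetP sCH /set0Pn[u uC] /forall_inP conC closC; have uH := sCH u uC.
have : u \in cover (components H).
  by rewrite (cover_partition (components_partition H)).
case/bigcupP=> D DH uD; suff -> : C = D by [].
have closedC : closed (adj_in H) C.
  apply: intro_closed; first exact: connect_adj_in_sym.
  by move=> x y /and3P[_ yH xy] xC; exact: closC xC yH xy.
apply/setP=> v; rewrite (component_connect _ DH uD); apply/idP/andP => [vC|[_]].
  split; first exact: sCH.
  have /forall_inP/(_ v vC) := conC u uC; apply: connect_sub => x y.
  by case/and3P=> xC yC xy; apply: connect1; rewrite /adj_in !sCH.
by move/(closed_connect closedC) <-.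
Qed.

Lemma mult_cover H Q : Q \subset components H ->
  mlt (cover Q) = (\sum_(C in Q) mlt C)%N.
Proof.
have [n] := ubnP #|Q|; elim: n Q => // n IHn Q ltQn sQ.
have [->|[C CQ]] := set_0Vmem Q.
  rewrite /cover !big_set0; apply/eqP; rewrite mult_eq0 matching_poly0.
  exact: root1.
have CH := subsetP sQ C CQ.
have tI := partition_trivIset (components_partition H).
have covQ : cover Q = C :|: cover (Q :\ C).
  by rewrite /cover (bigD1 C) //=; congr (_ :|: _); apply: eq_bigl => D;
    rewrite !inE andbC.
rewrite covQ multU.
- rewrite (bigD1 C) //=; congr (_ + _)%N; rewrite IHn.
  + by apply: eq_bigl => D; rewrite !inE andbC.
  + by move: ltQn; rewrite (cardsD1 C Q) CQ.
  + exact: subset_trans (subD1set _ _) sQ.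
- rewrite -setI_eq0; apply/eqP/setP=> x; rewrite !inE; apply/negP.
  case/andP=> xC /bigcupP[D]; rewrite !inE => /andP[DC DQ] xD.
  case/negP: DC; rewrite -(def_pblock tI CH xC).
  by rewrite -(def_pblock tI (subsetP sQ D DQ) xD).
- move=> x y xC /bigcupP[D]; rewrite !inE => /andP[DC DQ] yD; apply/negP => xy.
  have DH := subsetP sQ D DQ; have yH := subsetP (component_sub DH) y yD.
  have yC := component_adj CH xC yH xy; case/negP: DC.
  by rewrite -(def_pblock tI CH yC) -(def_pblock tI DH yD).
Qed.

Lemma mult_components H : mlt H = (\sum_(C in components H) mlt C)%N.
Proof.
rewrite -(mult_cover (subxx (components H))).
by rewrite (cover_partition (components_partition H)).
Qed.

(** * Critical components and the Gallai-Edmonds barrier *)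

Definition critical_components H := [set C in components H | critical theta C].

Lemma critical_components_sub H : critical_components H \subset components H.
Proof. by apply/subsetP=> C; rewrite inE => /andP[]. Qed.

Lemma mult_critical_components H :
  mlt (cover (critical_components H)) = num_critical theta H.
Proof.
rewrite (mult_cover (critical_components_sub H)).
rewrite (eq_bigr (fun=> 1%N)) ?sum1_card // => C.
by rewrite inE => /andP[_ /andP[_ /eqP]].
Qed.

Lemma num_critical_le_mult H : (num_critical theta H <= mlt H)%N.
Proof.
rewrite -mult_critical_components (mult_cover (critical_components_sub H)).
rewrite mult_components [leqRHS](bigID (critical theta)) /=.
rewrite (eq_bigl (fun C => (C \in components H) && critical theta C)).
  exact: leq_addr.
by move=> C; rewrite inE.
Qed.

Lemma component_essential H C u : C \in components H -> u \in C ->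
  essential theta C u = essential theta H u.
Proof.
move=> CH uC; have sCH := component_sub CH.
have splitH : H = C :|: (H :\: C).
  by rewrite setDE setUIr setUCr setIT (setUidPr sCH).
have dC : [disjoint C & H :\: C].
  by rewrite disjoint_sym disjoints_subset setDE subsetIr.
have nC : {in C & H :\: C, forall x y, ~~ adj x y}.
  move=> x y xC; rewrite inE => /andP[yC yH]; apply: contra yC.
  exact: component_adj CH xC yH.
have splitHu : H :\ u = (C :\ u) :|: (H :\: C).
  rewrite {1}splitH setDUl; congr (_ :|: _); apply/setDidPl.
  by rewrite disjoint_sym disjoints1 inE uC.
have mH : mlt H = (mlt C + mlt (H :\: C))%N by rewrite {1}splitH multU.
have mHu : mlt (H :\ u) = (mlt (C :\ u) + mlt (H :\: C))%N.
  rewrite splitHu multU ?(disjointWl (subD1set _ _) dC) //.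
  by move=> x y; rewrite inE => /andP[_]; exact: nC.
by rewrite /essential mH mHu -addSn eqn_add2r.
Qed.

Lemma critical_component_essential H C u :
  C \in critical_components H -> u \in C -> essential theta H u.
Proof.
rewrite inE => /andP[CH /andP[/forall_inP essC _]] uC.
by rewrite -(component_essential CH uC) essC.
Qed.

(** Without special vertices, being essential spreads along edges. A component is then either wholly
    essential, so critical with multiplicity 1 by [gallai], or free of essential vertices, so of
    multiplicity 0. *)
Lemma mult_eq_num_critical H : {in H, forall u, ~~ special theta H u} ->
  mlt H = num_critical theta H.
Proof.
move=> noS; rewrite mult_components /num_critical -sum1_card.
rewrite [RHS](eq_bigl (fun C => (C \in components H) && critical theta C));
  last by move=> C; rewrite inE.
rewrite [RHS]big_mkcondr /=; apply: eq_bigr => C CH.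
have sCH := subsetP (component_sub CH).
have [/exists_inP[u uC eu]|/exists_inP noE] :=
  boolP [exists u in C, essential theta C u].
  suff crC : critical theta C by rewrite crC; case/andP: crC => _ /eqP.
  apply: (gallai uC); first exact: component_connected CH.
  move=> v vC; have closedE : closed (adj_in C) (essential theta H).
    apply: intro_closed; first exact: connect_adj_in_sym.
    move=> x y /and3P[xC yC xy]; rewrite -!topredE /= => ex.
    apply: contraT => ey.
    have := noS y (sCH _ yC); rewrite /special ey /= negb_exists_in.
    by move/forall_inP/(_ x (sCH _ xC)); rewrite adj_sym xy ex.
  have /forall_inP/(_ _ uC)/forall_inP/(_ _ vC) := component_connected CH.
  move/(closed_connect closedE); rewrite -!topredE /=.
  by rewrite -!(component_essential CH) // eu => <-.
have mC0 : mlt C = 0%N.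
  apply/eqP; rewrite -leqn0 leqNgt; apply/negP => /essential_exists[u uC eu].
  by apply: noE; exists u.
by rewrite /critical mC0 andbF.
Qed.

(** Special vertices are deleted one at a time. Each is positive, so multiplicity and [#|S|] grow
    together, and by [special_stable] the vertex [w] remains neither essential nor special. *)
Lemma barrier_exists H : exists2 S, barrier theta H S &
  forall w, w \in H -> ~~ essential theta H w -> ~~ special theta H w ->
    w \notin S /\ (forall C, C \in critical_components (H :\: S) -> w \notin C).
Proof.
have [n] := ubnP #|H|; elim: n H => // n IHn H ltHn.
have [/exists_inP[a aH spa]|noS] := boolP [exists a in H, special theta H a];
  last first.
  exists set0 => [|w wH nw _].
    rewrite /barrier sub0set cards0 addn0 setD0 mult_eq_num_critical ?eqxx //.
    by move=> u uH; apply: contra noS => su; apply/exists_inP; exists u.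
  rewrite inE setD0; split=> // C CH; apply: contra nw.
  exact: critical_component_essential CH.
have /andP[na /exists_inP[b bH /andP[ab eb]]] := spa.
have /eqP ma := positive_of_adj_essential aH bH ab eb na.
have ltHa : (#|H :\ a| < n)%N by move: ltHn; rewrite (cardsD1 a H) aH.
have [S /andP[sS /eqP barS] keepS] := IHn _ ltHa.
have aS : a \notin S by apply/negP=> /(subsetP sS); rewrite !inE eqxx.
have delE : H :\: (a |: S) = H :\ a :\: S by rewrite setDDl.
exists (a |: S) => [|w wH nw sw].
  rewrite /barrier delE -barS ma cardsU1 aS subUset sub1set aH.
  rewrite (subset_trans sS) ?subD1set //=.
  by rewrite addnS addSn eqxx.
have wa : w != a by apply: contraNneq sw => ->.
have stable v :
    v \in H :\ a -> essential theta (H :\ a) v -> essential theta H v.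
  by rewrite !inE => /andP[va vH]; exact: special_stable ab eb na.
have wHa : w \in H :\ a by rewrite !inE wa.
rewrite delE inE negb_or inE wa /=; apply: keepS => //.
  by apply: contra nw; exact: stable.
apply: contra sw => /andP[_ /exists_inP[v vHa /andP[wv ev]]].
rewrite /special nw; apply/exists_inP; exists v; last by rewrite wv stable.
by move: vHa; rewrite inE => /andP[].
Qed.

End Multiplicity.

(** * A barrier with two adjacent vertices *)

Theorem theorem5p2 (R : realType) (theta : R) (G : sgraph) :
  connected [set: G] -> base theta [set: G] -> elementary theta [set: G].
Proof.
move=> conG /andP[superG /forall_inP indepG]; rewrite /elementary superG /=.
have /andP[/eqP multG /forall_inP posG] := superG.
apply/forall_inP => v _; apply/eqP/setP => w; rewrite [RHS]inE; apply/negP.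
rewrite inE => /andP[wGv /andP[/eqP pw sw]].
have multGv : mult theta ([set: G] :\ v) = 1%N.
  by have /eqP := posG v (in_setT v); rewrite multG.
have nw : ~~ essential theta ([set: G] :\ v) w.
  by rewrite essentialN // pw leqnSn.
have [S /andP[sS /eqP barS] keepS] := barrier_exists theta ([set: G] :\ v).
have [wS wcrit] := keepS w wGv nw sw.
have vS : v \notin S by apply/negP=> /(subsetP sS); rewrite !inE eqxx.
pose X := v |: S; pose D := cover (critical_components theta ([set: G] :\: X)).
pose B := [set: G] :\: (X :|: D).
have delX : [set: G] :\ v :\: S = [set: G] :\: X by rewrite setDDl.
(* The multiplicity 1 of [G] without [v] pays for the extra vertex [v] of [X]. *)
have cardX : #|X| = num_critical theta ([set: G] :\: X).
  by rewrite -delX -barS multGv cardsU1 vS.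
have critX := critical_components_sub theta ([set: G] :\: X).
have multD : mult theta D = #|X| by rewrite mult_critical_components cardX.
have DX x : x \in D -> x \notin X.
  case/bigcupP=> C /(subsetP critX)/component_sub/subsetP sC /sC.
  by rewrite !inE andbT.
have dXD : [disjoint X & D].
  by rewrite disjoint_sym disjoints_subset; apply/subsetP=> x /DX; rewrite !inE.
have dXB : [disjoint X & B].
  by rewrite disjoint_sym disjoints_subset; apply/subsetP=> x;
    rewrite !inE !negb_or => /andP[/andP[]].
have dDB : [disjoint D & B].
  by rewrite disjoint_sym disjoints_subset; apply/subsetP=> x;
    rewrite inE => /andP[]; rewrite !in_setU !negb_or !inE => /andP[].
have nDB : {in D & B, forall x y, ~~ adj x y}.
  move=> x y /bigcupP[C CX xC]; rewrite inE in_setU negb_or.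
  case/andP=> /andP[yX yD] _.
  apply: contra yD => xy; apply/bigcupP; exists C => //.
  by apply: (component_adj (subsetP critX C CX) xC) xy; rewrite inE yX inE.
have GE : [set: G] = X :|: D :|: B.
  by apply/setP=> x; rewrite /B setDE setTI setUCr.
have wB : w \in B.
  rewrite inE in_setU negb_or in_setT andbT; apply/andP; split.
    by move: wGv wS; rewrite !inE andbT negb_or => -> ->.
  by apply/bigcupP=> -[C]; rewrite -delX => /wcrit/negP.
(* Otherwise [B], which has no edge to [D] either, would be closed under adjacency; but it contains
   [w] and not [v]. *)
have [u uB [x xX xu]] : exists2 u, u \in B &
    exists2 x, x \in X & adj x u.
  have [/exists_inP[u uB /exists_inP[x xX xu]]|noXB] :=
    boolP [exists u in B, exists x in X, adj x u].
    by exists u => //; exists x.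
  have closedB : closed (adj_in [set: G]) B.
    apply: intro_closed; first exact: connect_adj_in_sym.
    move=> y z /and3P[_ _ yz] yB; have := in_setT z; rewrite GE 2!in_setU.
    case/orP=> [/orP[zX|zD]|//].
      case/negP: noXB; apply/exists_inP; exists y => //; apply/exists_inP.
      by exists z => //; rewrite adj_sym.
    by have := nDB z y zD yB; rewrite adj_sym yz.
  have /forall_inP/(_ w (in_setT w))/forall_inP/(_ v (in_setT v)) := conG.
  move/(closed_connect closedB); rewrite wB => /esym vB.
  by have := disjointFl dXB vB; rewrite setU11.
have rootG : (matching_poly R [set: G]).[theta] != 0.
  by have := mult_eq0 theta [set: G]; rewrite multG eqxx => /esym.
have hornerG := horner_matching_polyU dXD dXB dDB nDB (eq_leq (esym multD)).
rewrite GE hornerG mulf_eq0 negb_or in rootG; case/andP: rootG => rootXD rootB.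
have multB : mult theta B = 0%N by apply/eqP; rewrite mult_eq0.
have uXD : u \notin X :|: D by move: uB; rewrite inE => /andP[].
have nDBu : {in D & B :\ u, forall y z, ~~ adj y z}.
  by move=> y z yD; rewrite inE => /andP[_]; exact: nDB.
(* The factor of [X :|: D] is nonzero at [theta], so the zero of [mu(G \ u)] must come from
   [B :\ u]. *)
have multBu : mult theta (B :\ u) = 1%N.
  apply/eqP; rewrite eqn_leq; apply/andP; split.
    by have := interlace_ge theta uB; rewrite multB.
  rewrite lt0n mult_eq0 negbK rootE.
  have := horner_matching_polyU dXD (disjointWr (subD1set B u) dXB)
    (disjointWr (subD1set B u) dDB) nDBu (eq_leq (esym multD)).
  have -> : X :|: D :|: (B :\ u) = [set: G] :\ u.
    rewrite [in RHS]GE setDUl; congr (_ :|: _).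
    by apply/esym/setDidPl; rewrite disjoint_sym disjoints1.
  have /rootP -> : root (matching_poly R ([set: G] :\ u)) theta.
    rewrite -[root _ _]negbK -mult_eq0 -lt0n.
    by have /eqP -> := posG u (in_setT u).
  by move/esym/eqP; rewrite mulf_eq0 (negPf rootXD).
have [S' /andP[sS' /eqP barS'] _] := barrier_exists theta (B :\ u).
pose Y := X :|: (u |: S').
have uS' : u \notin S' by apply/negP=> /(subsetP sS'); rewrite !inE eqxx.
have sS'B : S' \subset B := subset_trans sS' (subD1set B u).
have suS'B : u |: S' \subset B by rewrite subUset sub1set uB.
have cardY : #|Y| = (#|X| + #|S'|.+1)%N.
  rewrite cardsU cardsU1 uS' -[RHS]subn0; congr (_ - _)%N.
  by apply/eqP; rewrite cards_eq0 setI_eq0 (disjointWr suS'B).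
pose QD := critical_components theta ([set: G] :\: X).
pose QB := critical_components theta (B :\ u :\: S').
(* Only vertices of [B] are deleted further, and these are disjoint from [D]. *)
have QDY : QD \subset critical_components theta ([set: G] :\: Y).
  apply/subsetP=> C CQ; have CX := subsetP critX C CQ.
  have sCD : C \subset D by exact: bigcup_sup CQ.
  move: (CQ); rewrite !inE => /andP[_ ->]; rewrite andbT.
  apply: componentI; [|exact: component_neq0 CX|exact: component_connected CX|].
    rewrite setDE setTI -disjoints_subset disjoint_sym -setI_eq0 setIUl setU_eq0.
    by rewrite !setI_eq0 (disjointWr sCD) // disjoint_sym (disjointW sCD suS'B).
  move=> y z yC; rewrite in_setD in_setU negb_or => /andP[/andP[zX _] _].
  by apply: (component_adj CX yC); rewrite in_setD zX in_setT.
have inY z : (z \in Y) = [|| z \in X, z == u | z \in S'].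
  by rewrite in_setU in_setU1.
have sBX z : z \in B -> z \notin X by move/(disjointFl dXB) ->.
have sCB C : C \in QB -> C \subset B :\ u :\: S'.
  by move/(subsetP (critical_components_sub _ _))/component_sub.
(* Outside [B], vertices of [B] have neighbours only in [X], which is deleted. *)
have QBY : QB \subset critical_components theta ([set: G] :\: Y).
  apply/subsetP=> C CQ.
  have CB := subsetP (critical_components_sub theta (B :\ u :\: S')) C CQ.
  move: (CQ); rewrite [in X in X -> _]inE [in X in _ -> X]inE => /andP[_ ->].
  rewrite andbT; apply: componentI.
  - apply: subset_trans (sCB C CQ) _; apply/subsetP=> z.
    rewrite in_setD in_setD1 => /andP[zS' /andP[zu zB]].
    by rewrite in_setD inY !negb_or zS' zu sBX // in_setT.
  - exact: component_neq0 CB.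
  - exact: component_connected CB.
  move=> y z yC; rewrite in_setD inY !negb_or => /andP[/and3P[zX zu zS'] _] yz.
  apply: (component_adj CB yC _ yz); rewrite in_setD zS' in_setD1 zu /=.
  have := in_setT z; rewrite GE 2!in_setU (negPf zX) /= => /orP[zD|//].
  have yB : y \in B.
    by have := subsetP (sCB C CQ) y yC; rewrite in_setD in_setD1 => /and3P[].
  by have := nDB z y zD yB; rewrite adj_sym yz.
have disQ : [disjoint QD & QB].
  rewrite -setI_eq0; apply/eqP/setP=> C; rewrite in_set0 in_setI; apply/negP.
  case/andP=> CQD CQB; have CX := subsetP critX C CQD.
  have /set0Pn[y yC] := component_neq0 CX.
  have yD : y \in D by apply/bigcupP; exists C.
  have := subsetP (sCB C CQB) y yC; rewrite in_setD in_setD1 => /and3P[_ _ yB].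
  by rewrite (disjointFr dDB yD) in yB.
(* [QD] supplies [#|X|] critical components and [QB] supplies [#|S'|.+1]; interlacing from
   multiplicity 0 forbids more than [#|Y|]. *)
have barY : barrier theta [set: G] Y.
  rewrite /barrier subsetT multG /= add0n eqn_leq; apply/andP; split.
    apply: (@leq_trans #|QD :|: QB|).
      rewrite cardsU (eqP (_ : QD :&: QB == set0)) ?setI_eq0 // cards0 subn0.
      by rewrite cardY -add1n -multBu barS' cardX.
    by apply: subset_leq_card; rewrite subUset QDY.
  apply: leq_trans (num_critical_le_mult theta _) _.
  by have := interlace_ge_setD theta (subsetT Y); rewrite multG.
have barsY : Y \in barriers theta [set: G] by rewrite inE.
have /forall_inP/(_ x) := indepG Y barsY.
by rewrite inY xX => /(_ isT)/forall_inP/(_ u);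
  rewrite inY eqxx orbT xu => /(_ isT).
Qed.
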